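(* Let $f:(\mathbb{R}^2,q)\to(\mathbb{R}^3,p)$ be a map-germ such that $q$ is a cuspidal edge, and let $\nu$ be a unit normal vector field along $f$. Let $\Delta_p$ be the curvature parabola, $\mathrm{I}$, $\mathrm{II}$, $\mathrm{II}_\nu$ the fundamental forms at $q$ (with $\mathrm{II}_\nu$ taken along $\nu(q)$), and $\kappa_s,\kappa_n,\kappa_u$ the singular, normal and umbilic curvatures. Then the following hold. (a) $\nu(q)$ is orthogonal to the line $\ell$ which contains $\Delta_p$. Therefore $$\kappa_u(q)=\frac{|\mathrm{II}_\nu(X,X)|}{\mathrm{I}(X,X)}$$ for any $X\in T_q\mathbb{R}^2$ with $\mathrm{I}(X,X)\neq 0$. (b) $\kappa_u(q)=\kappa_n(q)$. (c) $\kappa_s(q)=0$ if and only if $\mathrm{II}(X,X)$ is parallel to $\nu(q)$ (i.e. is a real multiple, possibly zero, of $\nu(q)$), where $X$ is a non-zero tangent vector to $S(f)$ at $q$. (d) $\kappa_u(q)=\kappa_s(q)=0$ if and only if $\mathrm{II}(X,X)=0$, where $X$ is a non-zero tangent vector to $S(f)$ at $q$.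
   Context: All maps are $C^\infty$; $\langle\cdot,\cdot\rangle$ is the Euclidean inner product of $\mathbb{R}^3$. Cuspidal edge: a singular point $q$ of $f$ is a cuspidal edge if the germ of $f$ at $q$ becomes $(u,v)\mapsto(u,v^2,v^3)$ at $0$ after composing with diffeomorphism-germs of source and target. Near such a point the singular set $S(f)$ is a regular curve, all of whose points are cuspidal edges, $\ker df$ is one-dimensional along $S(f)$ and transverse to $S(f)$, and there is a smooth unit vector field $\nu$ along $f$ orthogonal to the image of $df$ (unit normal vector field). A null vector field $\eta$ is a nowhere vanishing smooth vector field near $q$ with $df(\eta)=0$ on $S(f)$. The signed area density is $\lambda=\det(f_u,f_v,\nu)$, where $(u,v)$ are positively oriented coordinates of the source; $d\lambda(\eta)\ne0$ at a cuspidal edge. Singular and normal curvature: let $\gamma(t)$ be a regular parametrization of $S(f)$, $\hat\gamma=f\circ\gamma$, and choose $\eta$ so that $(\gamma'(t),\eta(t))$ is positively oriented. Then, at $\gamma(t)$, $$\kappa_s=\operatorname{sgn}(d\lambda(\eta))\frac{\det(\hat\gamma',\hat\gamma'',\nu(\gamma))}{|\hat\gamma'|^3},\qquad \kappa_\nu=\frac{\langle\hat\gamma'',\nu(\gamma)\rangle}{|\hat\gamma'|^2},\qquad \kappa_n=|\kappa_\nu|.$$ Fundamental forms at $q$: let $M$ be the image of $f$, $T_pM=\operatorname{Im}df_q$ (a line), $N_pM$ its orthogonal complement in $T_p\mathbb{R}^3$ (a plane), and $w\mapsto w^\perp$ the orthogonal projection $T_p\mathbb{R}^3\to N_pM$.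 The first fundamental form is $\mathrm{I}(X,Y)=\langle df_q(X),df_q(Y)\rangle$ on $T_q\mathbb{R}^2$. The second fundamental form $\mathrm{II}:T_q\mathbb{R}^2\times T_q\mathbb{R}^2\to N_pM$ is the symmetric bilinear map with $\mathrm{II}(\partial_u,\partial_u)=f_{uu}^\perp(q)$, $\mathrm{II}(\partial_u,\partial_v)=f_{uv}^\perp(q)$, $\mathrm{II}(\partial_v,\partial_v)=f_{vv}^\perp(q)$ (it does not depend on the coordinates). For $\nu\in N_pM$, $\mathrm{II}_\nu(X,Y)=\langle\mathrm{II}(X,Y),\nu\rangle$. Curvature parabola and umbilic curvature: $\Delta_p=\{\mathrm{II}(X,X): X\in T_q\mathbb{R}^2,\ \mathrm{I}(X,X)^{1/2}=1\}\subset N_pM$. At a cuspidal edge $\Delta_p$ is a half-line, contained in a unique line $\ell\subset N_pM$. For a parametrization $\alpha:\mathbb{R}\to N_pM$ of $\Delta_p$, the umbilic curvature is $\kappa_u(q)=|\alpha(s)\times\alpha'(s)|/|\alpha'(s)|$ for any $s$ with $\alpha'(s)\ne0$; this is independent of choices and equals the distance between $p$ (the origin of $N_pM$) and $\ell$. *)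

(* Defs.v *)
From HB Require Import structures.
From mathcomp Require Import all_boot all_order all_algebra.
From mathcomp Require Import all_classical all_reals all_analysis.

Set Implicit Arguments.
Unset Strict Implicit.
Unset Printing Implicit Defensive.

Import Order.TTheory GRing.Theory Num.Theory.
Import numFieldNormedType.Exports.

Local Open Scope ring_scope.
Local Open Scope classical_set_scope.

Section Smooth.
Context {R : realType} {V W : normedModType R}.

(* In finite dimension, on an open U, [class_C n U f] is the usual C^n:
   all iterated directional derivatives of order <= n exist and are
   continuous on U. *)
Fixpoint class_C (n : nat) (U : set V) (f : V -> W) : Prop :=
  match n with
  | 0%N => forall x, U x -> {for x, continuous f}
  | m.+1 => (forall x, U x -> differentiable f x) /\
            (forall v : V, class_C m U ('D_v f))
  end.

Definition smooth_on (U : set V) (f : V -> W) : Prop :=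
  forall n, class_C n U f.

(* Germs at x are represented by total functions; only the values near x are
   constrained. *)
Definition smooth_at (x : V) (f : V -> W) : Prop :=
  exists2 U, open_nbhs x U & smooth_on U f.

End Smooth.

Definition diffeo_germ {R : realType} {V W : normedModType R} (x : V)
    (phi : V -> W) : Prop :=
  smooth_at x phi /\
  exists psi : W -> V,
    [/\ smooth_at (phi x) psi,
        \forall y \near x, psi (phi y) = y &
        \forall z \near phi x, phi (psi z) = z].

Section Euclidean.
Context {R : realType}.
Implicit Types u v w : 'rV[R]_3.

(* The library norm `|u| on row vectors is the sup norm, hence the explicit
   Euclidean structure. *)
Definition dot u v : R := (u *m v^T) 0 0.

Definition enorm u : R := Num.sqrt (dot u u).

Definition det3 u v w : R := \det (col_mx u (col_mx v w) : 'M[R]_3).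

Definition cross u v : 'rV[R]_3 := \row_k det3 (delta_mx 0 k) u v.

End Euclidean.

Definition det2 {R : realType} (u v : 'rV[R]_2) : R :=
  \det (col_mx u v : 'M[R]_2).

Section CuspidalEdge.
Context {R : realType}.
Implicit Types (f nu : 'rV[R]_2 -> 'rV[R]_3) (q : 'rV[R]_2).

(* (u, v) |-> (u, v^2, v^3) *)
Definition cuspidal_model (x : 'rV[R]_2) : 'rV[R]_3 :=
  \row_(i < 3) [:: x 0 0; x 0 1 ^+ 2; x 0 1 ^+ 3]`_i.

Definition cuspidal_edge f q : Prop :=
  exists (phi : 'rV[R]_2 -> 'rV[R]_2) (Phi : 'rV[R]_3 -> 'rV[R]_3),
    [/\ phi 0 = q, diffeo_germ 0 phi, diffeo_germ (f q) Phi &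
        \forall x \near (0 : 'rV[R]_2), Phi (f (phi x)) = cuspidal_model x].

Definition singular f : set 'rV[R]_2 := [set x | (\rank ('J f x) < 2)%N].

Definition unit_normal f q nu : Prop :=
  [/\ smooth_at q nu,
      \forall x \near q, enorm (nu x) = 1 &
      \forall x \near q, forall v : 'rV[R]_2, dot ('d f x v) (nu x) = 0].

Definition partial (i : 'I_2) f : 'rV[R]_2 -> 'rV[R]_3 :=
  'D_(delta_mx 0 i : 'rV[R]_2) f.

Definition area_density f nu (x : 'rV[R]_2) : R :=
  det3 (partial 0 f x) (partial 1 f x) (nu x).

(* gamma is a regular parametrization, near t0, of the germ at q of S(f): its
   points are singular, and every neighbourhood of t0 is mapped onto a
   neighbourhood of q in S(f). *)
Definition param_singular f q (gamma : R -> 'rV[R]_2) (t0 : R) : Prop :=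
  [/\ smooth_at (t0 : R^o) gamma,
      gamma t0 = q,
      \forall t \near t0, derive1 gamma t != 0,
      \forall t \near t0, singular f (gamma t) &
      forall T, nbhs t0 T ->
        \forall x \near q, singular f x -> (gamma @` T) x].

Definition null_field f q (eta : 'rV[R]_2 -> 'rV[R]_2) : Prop :=
  [/\ smooth_at q eta,
      \forall x \near q, eta x != 0 &
      \forall x \near q, singular f x -> 'd f x (eta x) = 0].

Definition pos_oriented (gamma : R -> 'rV[R]_2) (t0 : R)
    (eta : 'rV[R]_2 -> 'rV[R]_2) : Prop :=
  \forall t \near t0, 0 < det2 (derive1 gamma t) (eta (gamma t)).

Definition singular_curvature f nu (gamma : R -> 'rV[R]_2)
    (eta : 'rV[R]_2 -> 'rV[R]_2) (t : R) : R :=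
  Num.sg ('d (area_density f nu : _ -> R^o) (gamma t) (eta (gamma t))) *
  (det3 (derive1 (f \o gamma) t) (derive1n 2 (f \o gamma) t) (nu (gamma t)) /
   enorm (derive1 (f \o gamma) t) ^+ 3).

Definition signed_normal_curvature f nu (gamma : R -> 'rV[R]_2) (t : R) : R :=
  dot (derive1n 2 (f \o gamma) t) (nu (gamma t)) /
  enorm (derive1 (f \o gamma) t) ^+ 2.

Definition normal_curvature f nu (gamma : R -> 'rV[R]_2) (t : R) : R :=
  `|signed_normal_curvature f nu gamma t|.

(* T_pM = Im df_q is the row space of 'J f q (row-vector convention:
   'd f q v = v *m 'J f q), so N_pM = (T_pM)^\perp is the row space of
   kermx ('J f q)^T. *)
Definition normal_plane f q : 'M[R]_3 := kermx ('J f q)^T.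

Definition normal_proj f q (w : 'rV[R]_3) : 'rV[R]_3 :=
  w *m proj_mx (normal_plane f q) <<'J f q>>%MS.

Definition fund1 f q (X Y : 'rV[R]_2) : R := dot ('d f q X) ('d f q Y).

Definition fund2 f q (X Y : 'rV[R]_2) : 'rV[R]_3 :=
  (X 0 0 * Y 0 0) *: normal_proj f q (partial 0 (partial 0 f) q) +
  (X 0 0 * Y 0 1 + X 0 1 * Y 0 0) *:
    normal_proj f q (partial 1 (partial 0 f) q) +
  (X 0 1 * Y 0 1) *: normal_proj f q (partial 1 (partial 1 f) q).

Definition fund2_along f q (w : 'rV[R]_3) (X Y : 'rV[R]_2) : R :=
  dot (fund2 f q X Y) w.

Definition curvature_parabola f q : set 'rV[R]_3 :=
  [set fund2 f q X X | X in [set X | Num.sqrt (fund1 f q X X) = 1]].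

(* The value |alpha x alpha'| / |alpha'| at a regular point of a
   parametrization of the curvature parabola. At a cuspidal edge such values
   exist and all coincide; the default 0 is used only if there is none. *)
Definition umbilic_curvature f q : R :=
  xget 0 [set k | exists (alpha : R -> 'rV[R]_3) (s : R),
    [/\ smooth_on [set: R^o] alpha,
        range alpha = curvature_parabola f q,
        derive1 alpha s != 0 &
        k = enorm (cross (alpha s) (derive1 alpha s)) / enorm (derive1 alpha s)]].

(* affine line contained in the row space of N *)
Definition line_in (N : 'M[R]_3) (l : set 'rV[R]_3) : Prop :=
  exists a d : 'rV[R]_3,
    [/\ (a <= N)%MS, (d <= N)%MS, d != 0 &
        l = [set a + t *: d | t in [set: R]]].

Definition orthogonal_line (w : 'rV[R]_3) (l : set 'rV[R]_3) : Prop :=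
  forall x y, l x -> l y -> dot w (y - x) = 0.

Definition tangent_at (gamma : R -> 'rV[R]_2) (t : R) (X : 'rV[R]_2) : Prop :=
  exists c : R, X = c *: derive1 gamma t.

End CuspidalEdge.

(* Main.v *)
Require Import Defs.
From HB Require Import structures.
From mathcomp Require Import all_boot all_order all_algebra.
From mathcomp Require Import all_classical all_reals all_analysis.
From mathcomp Require Import ring lra.

Set Implicit Arguments.
Unset Strict Implicit.
Unset Printing Implicit Defensive.

Import Order.TTheory GRing.Theory Num.Theory.
Import numFieldNormedType.Exports.

Local Open Scope ring_scope.
Local Open Scope classical_set_scope.

(* Write f near q as Psi o g o psi with g = (u, v^2, v^3), and let T, E be the
   images of the coordinate vectors under the differential at 0 of the inverse
   of psi. Then D_E f(q) = 0, D_T f(q) <> 0, and differentiating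
   Phi o f = g o psi along E, then along T or E (where Phi = Psi^-1; the second
   derivative of Phi drops out because D_E f(q) = 0), shows that D_T D_E f(q)
   is parallel to D_T f(q), while D_E D_E f(q) is not. Hence
   II(xT + yE) = x^2 II(T,T) + y^2 II(E,E) with II(E,E) <> 0, so the curvature
   parabola is a half-line directed by II(E,E). Differentiating
   <D_E f, nu> = 0 along E shows that nu(q) is orthogonal to II(E,E); since
   D_T f(q), nu(q), II(E,E) is an orthogonal frame, the distance from the
   origin to the line is the nu-component of II(T,T) / I(T,T).
   The parametrization gamma of the singular curve is transverse to E because
   (gamma', eta) is positively oriented and eta(q) is parallel to E, and
   d lambda(E) is a nonzero multiple of det(D_T f, D_E D_E f, nu) <> 0. *)

(** * Directional derivatives and twice differentiable maps *)

Section Calculus.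
Context {R : realType} {V : normedModType R}.

Lemma is_derive_coord {m n} (g : V -> 'M[R]_(m, n)) x v i j :
  derivable g x v -> is_derive x v (fun y => g y i j) ('D_v g x i j).
Proof.
move=> dg; apply: DeriveDef; first by case: (derivable_mxP g x v) => H _; exact: H.
by rewrite derive_mx // mxE.
Qed.

Lemma is_derive_mx {m n} (g : V -> 'M[R]_(m, n)) x v (dg : 'M[R]_(m, n)) :
  (forall i j, is_derive x v (fun y => g y i j) (dg i j)) -> is_derive x v g dg.
Proof.
move=> H; have d : derivable g x v by apply/(derivable_mxP g x v) => i j; case: (H i j).
apply: DeriveDef => //; rewrite derive_mx //; apply/matrixP => i j.
by rewrite mxE; case: (H i j).
Qed.

Lemma is_derive_scale {m n} (k : V -> R) (g : V -> 'M[R]_(m, n)) x v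
    (dk : R) (dg : 'M[R]_(m, n)) :
  is_derive x v k dk -> is_derive x v g dg ->
  is_derive x v (fun y => k y *: g y) (dk *: g x + k x *: dg).
Proof.
move=> hk hg; apply: is_derive_mx => i j.
have hgij := @is_derive_coord _ _ g x v i j (@ex_derive _ _ _ _ _ _ _ hg).
rewrite (_ : (fun y => _) = k * (fun y => g y i j)); last first.
  by apply/funext => y; rewrite mxE.
apply: is_derive_eq; rewrite !mxE (@derive_val _ _ _ _ _ _ _ hg).
by rewrite addrC [_ *: dk]mulrC.
Qed.

(** A pointwise second-order condition, weaker than C^2, that still gives symmetric second
    derivatives. The smoothness of [f], [nu] and [gamma] enters the argument only through it. *)
Definition twice_differentiable {W : normedModType R} (F : V -> W) (x : V) :=
  (\forall y \near x, differentiable F y) /\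
  forall v, differentiable ('D_v F) x.

Lemma smooth_at_twice {W : normedModType R} (F : V -> W) x :
  smooth_at x F -> twice_differentiable F x.
Proof.
case=> U [oU Ux] sm; have [dU d2] := sm 2%N; split.
  by near do apply: dU; exact: open_nbhs_nbhs.
by move=> v; exact: (d2 v).1.
Unshelve. all: by end_near. Qed.

Lemma derive_scalel {W : normedModType R} (F : V -> W) x a u :
  differentiable F x -> 'D_(a *: u) F x = a *: 'D_u F x.
Proof. by move=> dF; rewrite !deriveE // linearZ. Qed.

Lemma derive_addl {W : normedModType R} (F : V -> W) x u v :
  differentiable F x -> 'D_(u + v) F x = 'D_u F x + 'D_v F x.
Proof. by move=> dF; rewrite !deriveE // linearD. Qed.

Lemma is_derive_comp {U W : normedModType R} (G : V -> U) (F : U -> W) x v :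
  differentiable G x -> differentiable F (G x) ->
  is_derive x v (F \o G) ('D_('D_v G x) F (G x)).
Proof.
move=> dG dF; have dFG := differentiable_comp dG dF.
apply: DeriveDef; first exact: diff_derivable.
by rewrite !deriveE // diff_comp.
Qed.

End Calculus.

(** * Symmetry of second derivatives *)

Section Symmetry.
Context {R : realType} {V : normedModType R}.

(** The little-o of the differential, unpacked into an explicit radius. *)
Lemma differentiable_approx {W : normedModType R} (G : V -> W) x :
  differentiable G x -> forall e, 0 < e -> exists2 r, 0 < r &
  forall y, `|y - x| < r -> `|G y - G x - 'D_(y - x) G x| <= e * `|y - x|.
Proof.
move=> dG e e0; move: (diff_locallyx dG); set k := 'o _ => E.
have /(littleoP [littleo of k]) /nbhs_ballP[r' r0' H'] := e0.
exists r' => // y yr; rewrite deriveE //.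
have := E (y - x); rewrite subrK => ->.
rewrite -[_ - G x - _]addrA -opprD [_ + k _]addrC addrK.
by apply: H'; rewrite -ball_normE /= add0r normrN.
Qed.

(* The mean value theorem applied to t |-> F(x+tu+hv) - F(x+tu) on [0, h]; the
   second difference is symmetric in u and v. *)
Lemma second_derivative_increment (F : V -> R) x u v :
  twice_differentiable F x ->
  forall e, 0 < e -> exists2 r, 0 < r & forall h, 0 < h < r ->
   `|F (h *: u + (h *: v + x)) - F (h *: u + x) - F (h *: v + x) + F x
     - h ^+ 2 * 'D_v ('D_u F) x| <= e * h ^+ 2.
Proof.
move=> [/nbhs_normP[r1 /= r10 dF] d2F] e e0.
(* For [t] in [0, h], the points [y1 t] and [y2 t] used below stay within [h * K] of [x]. *)
pose K := `|u| + `|v| + 1.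
have K0 : 0 < K by rewrite /K; have := normr_ge0 u; have := normr_ge0 v; lra.
(* The differentiability of ['D_u F] at [x] is used twice, each time with error at most e / (2K) *
   hK = (e / 2) h. *)
have e'0 : 0 < e / (2 * K) by rewrite divr_gt0 // mulr_gt0.
have [r2 r20 H] := differentiable_approx (d2F u) e'0.
pose r := Num.min r1 r2.
have r0 : 0 < r by rewrite lt_min r10.
exists (r / K); first exact: divr_gt0.
move=> h /andP[h0]; rewrite ltr_pdivlMr // => hr.
pose y1 (t : R) := t *: u + (h *: v + x); pose y2 (t : R) := t *: u + x.
have close1 (t : R) : 0 <= t <= h -> `|y1 t - x| <= h * K.
  move=> /andP[t0 th]; rewrite /y1 addrA addrK (le_trans (ler_normD _ _)) //.
  rewrite !normrZ (ger0_norm t0) (ger0_norm (ltW h0)) /K.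
  have := ler_wpM2r (normr_ge0 u) th; nra.
have close2 (t : R) : 0 <= t <= h -> `|y2 t - x| <= h * K.
  move=> /andP[t0 th]; rewrite /y2 addrK.
  rewrite !normrZ (ger0_norm t0) /K.
  have := ler_wpM2r (normr_ge0 u) th; have := normr_ge0 v; nra.
have dF' y : `|y - x| <= h * K -> differentiable F y.
  move=> yx; apply: dF; rewrite /= distrC (le_lt_trans yx) //.
  by rewrite (lt_le_trans hr) // ge_min lexx.
pose phi := (F \o y1) - (F \o y2).
pose dphi (t : R) : R := 'D_u F (y1 t) - 'D_u F (y2 t).
have dy z t : differentiable (fun t : R => t *: u + z) t /\
              'D_1 (fun t : R => t *: u + z) t = u.
  have D : is_diff t (fun t : R => t *: u + z) ( *:%R^~ u + 0).
    exact: is_diffD.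
  split; first by case: D.
  by rewrite deriveE ?diff_val /=; [rewrite /GRing.add /= addr0 scale1r|case: D].
have Dphi (t : R) : 0 <= t <= h -> is_derive t 1 phi (dphi t).
  move=> th; apply: is_deriveB.
    have [a b] := dy (h *: v + x) t.
    have := is_derive_comp (1 : R) a (dF' _ (close1 _ th)).
    by rewrite b.
  have [a b] := dy x t.
  have := is_derive_comp (1 : R) a (dF' _ (close2 _ th)).
  by rewrite b.
have [|| c] := MVT h0 (f := phi) (df := dphi).
- by move=> t; rewrite in_itv /= => /andP[t0 th]; apply: Dphi; rewrite !ltW.
- apply: continuous_in_subspaceT => t; rewrite inE /= in_itv /= => th.
  apply/differentiable_continuous/derivable1_diffP.
  exact: (@ex_derive _ _ _ _ _ _ _ (Dphi t th)).
rewrite in_itv /= => /andP[c0 ch] Ec.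
have E1 : phi h - phi 0 =
    F (h *: u + (h *: v + x)) - F (h *: u + x) - F (h *: v + x) + F x.
  rewrite /phi !fctE /y1 /y2 /= !scale0r !add0r; ring.
have cb : 0 <= c <= h by rewrite !ltW.
have cl1 := close1 _ cb; have cl2 := close2 _ cb.
have rK : h * K < r2 by rewrite (lt_le_trans hr) // ge_min lexx orbT.
have H1 := H _ (le_lt_trans cl1 rK); have H2 := H _ (le_lt_trans cl2 rK).
have D1 : 'D_(y1 c - x) ('D_u F) x = c * 'D_u ('D_u F) x + h * 'D_v ('D_u F) x.
  by rewrite /y1 addrA addrK derive_addl // !derive_scalel.
have D2 : 'D_(y2 c - x) ('D_u F) x = c * 'D_u ('D_u F) x.
  by rewrite /y2 addrK derive_scalel.
have {H1} H1 := le_trans H1 (ler_wpM2l (ltW e'0) cl1).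
have {H2} H2 := le_trans H2 (ler_wpM2l (ltW e'0) cl2).
have Ee : e / (2 * K) * (h * K) = e / 2 * h by field; rewrite gt_eqF.
rewrite -E1 Ec subr0 expr2 -mulrA [_ * h]mulrC -mulrBr normrM (gtr0_norm h0).
rewrite [e * _]mulrCA ler_pM2l //.
move: H1 H2; rewrite Ee D1 D2 /dphi.
move: ('D_u F (y1 c)) ('D_u F (y2 c)) ('D_u F x) (c * _) (h * _) => a b d p m H1 H2.
rewrite (_ : a - b - m = (a - d - (p + m)) - (b - d - p)); last by ring.
by rewrite (le_trans (ler_normB _ _)) // [e]splitr mulrDl lerD.
Qed.

(** Both iterated derivatives, multiplied by h^2, approximate the same second difference, so they
    differ by at most any e > 0. *)
Lemma derive_symm (F : V -> R) x u v :
  twice_differentiable F x -> 'D_v ('D_u F) x = 'D_u ('D_v F) x.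
Proof.
move=> d2; apply/eqP; rewrite -subr_eq0 -normr_le0; apply/ler_addgt0Pl => e e0.
rewrite addr0.
have e2 : 0 < e / 2 by lra.
have [r1 r10 H1] := second_derivative_increment u v d2 e2.
have [r2 r20 H2] := second_derivative_increment v u d2 e2.
pose h := Num.min r1 r2 / 2.
have h0 : 0 < h by rewrite divr_gt0 // lt_min r10.
have : h < Num.min r1 r2 by rewrite gtr_pMr ?invf_lt1 ?ltr1n // lt_min r10.
rewrite lt_min => /andP[hr1 hr2]; clearbody h.
have := H1 h; rewrite h0 hr1 => /(_ isT); have := H2 h; rewrite h0 hr2 => /(_ isT).
(* After this reordering both estimates speak of the same value of [F] at x + hu + hv. *)
rewrite (addrCA (h *: v) (h *: u)).
set a := 'D_v _ x; set b := 'D_u _ x.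
have hh : 0 < h ^+ 2 by rewrite exprn_gt0.
move=> Hb Ha.
rewrite -(ler_pM2r hh).
have -> : `|a - b| * h ^+ 2 = `|h ^+ 2 * a - h ^+ 2 * b|.
  by rewrite -mulrBr normrM (gtr0_norm hh) mulrC.
move: Ha Hb.
move: (h ^+ 2) (F _) (F _) (F _) (F _) => k D C B A Ha Hb.
rewrite (_ : k * a - k * b = (A - C - B + D - k * b) - (A - B - C + D - k * a));
  last by ring.
rewrite [e]splitr mulrDl.
apply: le_trans (ler_normB _ _) _.
exact: (lerD Hb Ha).
Qed.

End Symmetry.

(** * Euclidean geometry of R^3 *)

Section Det.
Context {R : realType}.
Implicit Types (u v w : 'rV[R]_3) (a b : 'rV[R]_2).

Lemma sum3E (F : 'I_3 -> R) : \sum_i F i = F 0 + F 1 + F 2.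
Proof.
rewrite !big_ord_recl big_ord0 addr0 addrA.
by congr (F _ + F _ + F _); apply/val_inj.
Qed.

Lemma sum2E {U : zmodType} (F : 'I_2 -> U) : \sum_i F i = F 0 + F 1.
Proof.
rewrite !big_ord_recl big_ord0 addr0.
by congr (F _ + F _); apply/val_inj.
Qed.

Lemma det_mx22 (M : 'M[R]_2) : \det M = M 0 0 * M 1 1 - M 0 1 * M 1 0.
Proof.
have l00 : lift 0 0 = 1 :> 'I_2 by apply/val_inj.
have l10 : lift 1 0 = 0 :> 'I_2 by apply/val_inj.
rewrite (expand_det_row _ 0) sum2E /cofactor !det_mx11 !mxE l00 l10 /=; ring.
Qed.

Lemma dotE u v : dot u v = u 0 0 * v 0 0 + u 0 1 * v 0 1 + u 0 2 * v 0 2.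
Proof. by rewrite /dot mxE sum3E !mxE. Qed.

Lemma det_mx33 (M : 'M[R]_3) : \det M =
  M 0 0 * (M 1 1 * M 2 2 - M 1 2 * M 2 1) +
  M 0 1 * (M 1 2 * M 2 0 - M 1 0 * M 2 2) +
  M 0 2 * (M 1 0 * M 2 1 - M 1 1 * M 2 0).
Proof.
rewrite (expand_det_row _ 0) sum3E /cofactor !det_mx22 !mxE.
have l00 : lift 0 0 = 1 :> 'I_3 by apply/val_inj.
have l01 : lift 0 1 = 2 :> 'I_3 by apply/val_inj.
have l10 : lift 1 0 = 0 :> 'I_3 by apply/val_inj.
have l11 : lift 1 1 = 2 :> 'I_3 by apply/val_inj.
have l20 : lift 2 0 = 0 :> 'I_3 by apply/val_inj.
have l21 : lift 2 1 = 1 :> 'I_3 by apply/val_inj.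
rewrite l00 l01 l10 l11 l20 l21 /=.
ring.
Qed.

Lemma det3E u v w : det3 u v w =
  u 0 0 * (v 0 1 * w 0 2 - v 0 2 * w 0 1) +
  u 0 1 * (v 0 2 * w 0 0 - v 0 0 * w 0 2) +
  u 0 2 * (v 0 0 * w 0 1 - v 0 1 * w 0 0).
Proof.
pose M := col_mx u (col_mx v w) : 'M[R]_3.
have M0 j : M 0 j = u 0 j.
  by rewrite -(col_mxEu u (col_mx v w)); congr (M _ j); exact/val_inj.
have M1 j : M 1 j = v 0 j.
  rewrite -(col_mxEu v w 0 j) -(col_mxEd u (col_mx v w) _ j).
  by congr (M _ j); exact/val_inj.
have M2 j : M 2 j = w 0 j.
  rewrite -(col_mxEd v w 0 j) -(col_mxEd u (col_mx v w) _ j).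
  by congr (M _ j); exact/val_inj.
by rewrite /det3 det_mx33 -/M !M0 !M1 !M2.
Qed.

Lemma det2E a b : det2 a b = a 0 0 * b 0 1 - a 0 1 * b 0 0.
Proof.
rewrite /det2 det_mx22.
pose M := col_mx a b : 'M[R]_2.
have M0 j : M 0 j = a 0 j.
  by rewrite -(col_mxEu a b); congr (M _ j); exact/val_inj.
have M1 j : M 1 j = b 0 j.
  by rewrite -(col_mxEd a b); congr (M _ j); exact/val_inj.
by rewrite -/M !M0 !M1.
Qed.

Lemma dotC u v : dot u v = dot v u.
Proof. by rewrite !dotE; ring. Qed.

Lemma dotDl u v w : dot (u + v) w = dot u w + dot v w.
Proof. by rewrite /dot mulmxDl mxE. Qed.

Lemma dotDr u v w : dot u (v + w) = dot u v + dot u w.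
Proof. by rewrite dotC dotDl !(dotC u). Qed.

Lemma dotZl k u v : dot (k *: u) v = k * dot u v.
Proof. by rewrite /dot -scalemxAl mxE. Qed.

Lemma dotZr k u v : dot u (k *: v) = k * dot u v.
Proof. by rewrite dotC dotZl dotC. Qed.

Lemma dotBl u v w : dot (u - v) w = dot u w - dot v w.
Proof. by rewrite -scaleN1r dotDl dotZl mulN1r. Qed.

Lemma dot0l u : dot 0 u = 0.
Proof. by rewrite -(scale0r 0) dotZl mul0r. Qed.

Lemma dot_ge0 u : 0 <= dot u u.
Proof. by rewrite dotE !addr_ge0 // -expr2 sqr_ge0. Qed.

Lemma row3P u v : u 0 0 = v 0 0 -> u 0 1 = v 0 1 -> u 0 2 = v 0 2 -> u = v.
Proof.
move=> h0 h1 h2; apply/rowP => -[[|[|[|//]]] i3].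
- by rewrite (_ : Ordinal i3 = 0) //; exact/val_inj.
- by rewrite (_ : Ordinal i3 = 1) //; exact/val_inj.
- by rewrite (_ : Ordinal i3 = 2) //; exact/val_inj.
Qed.

Lemma dot_eq0 u : (dot u u == 0) = (u == 0).
Proof.
apply/eqP/eqP => [|->]; last exact: dot0l.
move/eqP; rewrite dotE !paddr_eq0 ?addr_ge0 -?expr2 ?sqr_ge0 // !sqrf_eq0.
by move=> /andP[/andP[/eqP u0 /eqP u1] /eqP u2]; apply: row3P; rewrite ?u0 ?u1 ?u2 mxE.
Qed.

Lemma dot_gt0 u : u != 0 -> 0 < dot u u.
Proof. by move=> u0; rewrite lt0r dot_eq0 u0 dot_ge0. Qed.

Lemma enorm_sqr u : enorm u ^+ 2 = dot u u.
Proof. by rewrite /enorm sqr_sqrtr // dot_ge0. Qed.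

Lemma enorm_eq0 u : (enorm u == 0) = (u == 0).
Proof. by rewrite /enorm sqrtr_eq0 le_eqVlt ltNge dot_ge0 orbF dot_eq0. Qed.

Lemma enorm_ge0 u : 0 <= enorm u. Proof. exact: sqrtr_ge0. Qed.

(** Cramer's rule: the determinant times each coordinate of [c] is a combination of the three dot
    products, with cofactors as coefficients. *)
Lemma orthogonal_to_frame u v w c : det3 u v w != 0 ->
  dot c u = 0 -> dot c v = 0 -> dot c w = 0 -> c = 0.
Proof.
move=> /mulfI d0; rewrite !dotE => cu cv cw.
have cramer x y z : x * (c 0 0 * u 0 0 + c 0 1 * u 0 1 + c 0 2 * u 0 2) +
  y * (c 0 0 * v 0 0 + c 0 1 * v 0 1 + c 0 2 * v 0 2) +
  z * (c 0 0 * w 0 0 + c 0 1 * w 0 1 + c 0 2 * w 0 2) = 0.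
  by rewrite cu cv cw !mulr0 !addr0.
apply: row3P; rewrite !mxE; apply: d0; rewrite mulr0 det3E.
- rewrite -[RHS](cramer (v 0 1 * w 0 2 - v 0 2 * w 0 1)
    (w 0 1 * u 0 2 - w 0 2 * u 0 1) (u 0 1 * v 0 2 - u 0 2 * v 0 1)); ring.
- rewrite -[RHS](cramer (v 0 2 * w 0 0 - v 0 0 * w 0 2)
    (w 0 2 * u 0 0 - w 0 0 * u 0 2) (u 0 2 * v 0 0 - u 0 0 * v 0 2)); ring.
- rewrite -[RHS](cramer (v 0 0 * w 0 1 - v 0 1 * w 0 0)
    (w 0 0 * u 0 1 - w 0 1 * u 0 0) (u 0 0 * v 0 1 - u 0 1 * v 0 0)); ring.
Qed.

(** The right-hand side is the Gram determinant, expanded along its first row. *)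
Lemma det3_gram u v w : det3 u v w ^+ 2 =
  dot u u * (dot v v * dot w w - dot v w ^+ 2)
  - dot u v * (dot u v * dot w w - dot v w * dot u w)
  + dot u w * (dot u v * dot v w - dot v v * dot u w).
Proof. by rewrite det3E !dotE; ring. Qed.

Lemma det3_sqr_orthogonal u v w : dot u v = 0 -> dot u w = 0 -> dot v w = 0 ->
  det3 u v w ^+ 2 = dot u u * dot v v * dot w w.
Proof. by rewrite det3_gram => -> -> ->; ring. Qed.

Lemma crossE u v : cross u v = \row_k
  [:: u 0 1 * v 0 2 - u 0 2 * v 0 1; u 0 2 * v 0 0 - u 0 0 * v 0 2;
      u 0 0 * v 0 1 - u 0 1 * v 0 0]`_k.
Proof.
by apply: row3P; rewrite !mxE det3E !mxE /=; ring.
Qed.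

(** Lagrange's identity. *)
Lemma enorm_cross_sqr u v :
  enorm (cross u v) ^+ 2 = dot u u * dot v v - dot u v ^+ 2.
Proof. by rewrite enorm_sqr crossE !dotE !mxE /=; ring. Qed.

Lemma det3_combine u k v l w c :
  det3 u (k *: v + l *: w) c = k * det3 u v c + l * det3 u w c.
Proof. by rewrite !det3E !mxE; ring. Qed.

Lemma det3Zn k u v : det3 u (k *: v) v = 0.
Proof. by rewrite det3E !mxE; ring. Qed.

(** This is the product rule for det(f_u, f_v, nu) at a point where f_u and f_v are both multiples
    of one vector: the term that differentiates nu vanishes. *)
Lemma det3_collinear k l u v w c c' :
  det3 v (l *: u) c + det3 (k *: u) w c + det3 (k *: u) (l *: u) c' =
  k * det3 u w c - l * det3 u v c.
Proof. by rewrite !det3E !mxE; ring. Qed.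

End Det.

Section OrthogonalFrame.
Context {R : realType} (z n w : 'rV[R]_3).
Hypotheses (z0 : z != 0) (n1 : dot n n = 1) (w0 : w != 0).
Hypotheses (zn : dot z n = 0) (zw : dot z w = 0) (nw : dot n w = 0).

(** The difference of the two sides is orthogonal to [z], [n] and [w], which are linearly
    independent. *)
Lemma frame_decomposition a : dot a z = 0 ->
  a = dot a n *: n + (dot a w / dot w w) *: w.
Proof.
move=> az; apply/eqP; rewrite -subr_eq0; apply/eqP.
have ww : dot w w != 0 by rewrite dot_eq0.
apply: (@orthogonal_to_frame _ z n w).
- rewrite -sqrf_eq0 det3_sqr_orthogonal // n1 mulr1 mulf_eq0 !dot_eq0.
  by rewrite negb_or z0.
- by rewrite dotBl dotDl !dotZl az (dotC n) zn (dotC w) zw; ring.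
- by rewrite dotBl dotDl !dotZl n1 (dotC w) nw; ring.
- by rewrite dotBl dotDl !dotZl nw; field.
Qed.

(** The quotient is the distance from the origin to the line through [a] directed by [w]. Lagrange's
    identity and Pythagoras in the frame leave only the [n]-component of [a]. *)
Lemma enorm_cross_frame a : dot a z = 0 ->
  enorm (cross a w) / enorm w = `|dot a n|.
Proof.
move=> az; have ww : dot w w != 0 by rewrite dot_eq0.
have wn : enorm w != 0 by rewrite enorm_eq0.
apply/eqP; rewrite -(@eqrXn2 _ 2) ?divr_ge0 ?enorm_ge0 //.
rewrite expr_div_n enorm_cross_sqr enorm_sqr real_normK ?num_real //.
have -> : dot a a = dot a n ^+ 2 + dot a w ^+ 2 / dot w w.
  rewrite {2}(frame_decomposition az) dotDr !dotZr; by field.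
by apply/eqP; field.
Qed.

End OrthogonalFrame.

(** The part [c] of [b] orthogonal to [n] is also orthogonal to [z], so the squared determinant is
    |z|^2 |c|^2. *)
Lemma det3_eq0_parallel {R : realType} (z n b : 'rV[R]_3) :
  z != 0 -> dot n n = 1 -> dot z n = 0 -> dot b z = 0 -> det3 z b n = 0 ->
  b = dot b n *: n.
Proof.
move=> z0 n1 zn bz d0; apply/eqP; rewrite -subr_eq0.
set c := b - _.
have cz : dot z c = 0 by rewrite dotC dotBl dotZl bz (dotC n) zn mulr0 subr0.
have cn : dot c n = 0 by rewrite dotBl dotZl n1 mulr1 subrr.
have dc : det3 z c n = 0 by rewrite -[RHS]d0 /c !det3E !mxE; ring.
have : det3 z c n ^+ 2 = 0 by rewrite dc expr0n.
rewrite det3_sqr_orthogonal // n1 mulr1 => /eqP; rewrite mulf_eq0 !dot_eq0.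
by rewrite (negbTE z0).
Qed.

(** * Second-order differential calculus *)

Section SecondOrder.
Context {R : realType} {V : normedModType R}.

(** Differentiability depends only on the germ: the differential of [f] satisfies the first-order
    expansion of [g], and uniqueness identifies it with that of [g]. *)
Lemma near_eq_differentiable {W : normedModType R} (f g : V -> W) x :
  (\forall y \near x, f y = g y) -> differentiable f x -> differentiable g x.
Proof.
move=> fg df; have [dfc E] := (diff_locallyP _ _).1 df.
have fgx : f x = g x by exact: nbhs_singleton fg.
have E' : g \o shift x = cst (g x) + 'd f x +o_ 0 id.
  move/eqaddoP : E => E; apply/eqaddoP => e e0.
  have fg0 : \forall y \near 0, f (y + x) = g (y + x).
    by move: fg; rewrite (near_shift 0 x) subr0.
  near=> y; have -> : (g \o shift x - (cst (g x) + 'd f x)) y =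
      (f \o shift x - (cst (f x) + 'd f x)) y.
    rewrite !fctE /= -fgx; congr (_ - _); apply/esym; near: y; exact: fg0.
  by near: y; exact: E.
have dgE := diff_unique dfc E'.
by apply/diff_locallyP; rewrite dgE.
Unshelve. all: by end_near. Qed.

Lemma derive_coord {m n} (F : V -> 'M[R]_(m, n)) x u i j :
  differentiable F x -> 'D_u (fun y => F y i j) x = 'D_u F x i j.
Proof. by move=> dF; have [_] := is_derive_coord i j (diff_derivable (v := u) dF). Qed.

Lemma differentiable_entry {m n} (F : V -> 'M[R]_(m, n)) x i j :
  differentiable F x -> differentiable (fun y => F y i j : R) x.
Proof. by move=> dF; apply: differentiable_comp dF (differentiable_coord _ _ _). Qed.

Lemma twice_differentiable_coord {m n} (F : V -> 'M[R]_(m, n)) x i j :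
  twice_differentiable F x -> twice_differentiable (fun y => F y i j : R) x.
Proof.
move=> [dF d2F]; split.
  by apply: filterS dF => y; exact: differentiable_entry.
move=> v; apply: near_eq_differentiable (differentiable_entry i j (d2F v)).
by apply: filterS dF => y dFy; rewrite derive_coord.
Qed.

Lemma derive2_coord {m n} (F : V -> 'M[R]_(m, n)) x u v i j :
  twice_differentiable F x ->
  'D_v ('D_u (fun y => F y i j : R)) x = 'D_v ('D_u F) x i j.
Proof.
move=> [dF d2F]; apply: etrans (derive_coord v i j (d2F u)).
by apply: near_eq_derive; apply: filterS dF => y; exact: derive_coord.
Qed.

Lemma derive_symm_mx {m n} (F : V -> 'M[R]_(m, n)) x u v :
  twice_differentiable F x -> 'D_v ('D_u F) x = 'D_u ('D_v F) x.
Proof.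
move=> d2; apply/matrixP => i j.
have := derive_symm u v (twice_differentiable_coord i j d2).
by rewrite (derive2_coord u v i j d2) (derive2_coord v u i j d2).
Qed.

Lemma derive_mod_null {W : normedModType R} (F : V -> W) x a b u v :
  differentiable F x -> 'D_v F x = 0 -> 'D_(a *: u + b *: v) F x = a *: 'D_u F x.
Proof.
by move=> dF v0; rewrite derive_addl // !derive_scalel // v0 scaler0 addr0.
Qed.

(** Linearity in the inner direction holds at all points near [x], so it survives the outer
    derivative. *)
Lemma derive2_linear {W : normedModType R} (F : V -> W) x z a u v :
  twice_differentiable F x ->
  'D_z ('D_(a *: u + v) F) x = a *: 'D_z ('D_u F) x + 'D_z ('D_v F) x.
Proof.
move=> [dF d2F]; rewrite (near_eq_derive (g := (a \*: 'D_u F) + 'D_v F)).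
  have du := diff_derivable (v := z) (d2F u).
  have dv := diff_derivable (v := z) (d2F v).
  by rewrite (deriveD (derivableZ (k := a) du) dv) (deriveZ a du).
by apply: filterS dF => y dFy; rewrite derive_addl // derive_scalel.
Qed.

Lemma derive2_0 {W : normedModType R} (F : V -> W) x z : 'D_z ('D_0 F) x = 0.
Proof.
rewrite (_ : 'D_0 F = cst 0) ?derive_cst //.
by apply/funext => y; rewrite derive0.
Qed.

End SecondOrder.

Section RowExpansion.
Context {R : realType} {W : normedModType R} {n : nat}.
Variables (F : 'rV[R]_n.+1 -> W) (x : 'rV[R]_n.+1).

Lemma derive_row_expansion u : differentiable F x ->
  'D_u F x = \sum_i u 0 i *: 'D_(delta_mx 0 i : 'rV_n.+1) F x.
Proof.
move=> dF; rewrite deriveE // {1}(row_sum_delta u) linear_sum.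
by apply: eq_bigr => i _; rewrite linearZ /= deriveE.
Qed.

Lemma derive2_row_expansion z u : twice_differentiable F x ->
  'D_z ('D_u F) x = \sum_i u 0 i *: 'D_z ('D_(delta_mx 0 i : 'rV_n.+1) F) x.
Proof.
move=> d2; rewrite {1}(row_sum_delta u).
elim/big_rec2: _ => [|i y1 y2 _ IH]; first exact: derive2_0.
by rewrite derive2_linear // IH.
Qed.

End RowExpansion.

Section PlaneExpansion.
Context {R : realType} {W : normedModType R}.
Variables (F : 'rV[R]_2 -> W) (x : 'rV[R]_2).
Local Notation e := (fun i : 'I_2 => delta_mx 0 i : 'rV[R]_2).

Lemma derive_plane u : differentiable F x ->
  'D_u F x = u 0 0 *: 'D_(e 0) F x + u 0 1 *: 'D_(e 1) F x.
Proof. by move=> dF; rewrite derive_row_expansion // sum2E. Qed.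

Lemma derive2_plane z u : twice_differentiable F x ->
  'D_z ('D_u F) x = u 0 0 *: 'D_z ('D_(e 0) F) x + u 0 1 *: 'D_z ('D_(e 1) F) x.
Proof. by move=> d2; rewrite derive2_row_expansion // sum2E. Qed.

End PlaneExpansion.

(** Chain rule with both base point and direction moving. It yields the second derivatives of
    [Phi \o f] and of [f \o gamma]. Expanding [c y] in the standard basis reduces it to products of
    scalar coefficients with fixed-direction derivatives. *)
Lemma is_derive_along {R : realType} {V : normedModType R} {n m p}
    (F : 'rV[R]_n.+1 -> 'M[R]_(m.+1, p.+1)) (G c : V -> 'rV[R]_n.+1) x w :
  twice_differentiable F (G x) -> differentiable G x -> derivable c x w ->
  is_derive x w (fun y => 'D_(c y) F (G y))
    ('D_('D_w c x) F (G x) + 'D_('D_w G x) ('D_(c x) F) (G x)).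
Proof.
move=> d2 dG dc; have [dF d2F] := d2.
pose e (i : 'I_n.+1) : 'rV[R]_n.+1 := delta_mx 0 i.
pose S := \sum_(i < n.+1) (fun y => c y 0 i *: 'D_(e i) F (G y)).
apply: (@near_eq_is_derive _ _ _ S).
  have : \forall y \near x, differentiable F (G y).
    have cG : G @ x --> G x := differentiable_continuous dG.
    exact: (cG _ dF).
  by apply: filterS => y dFy; rewrite derive_row_expansion // /S fct_sumE.
apply: is_derive_eq.
  apply: is_derive_sum => i; apply: is_derive_scale.
    exact: is_derive_coord.
  exact: (is_derive_comp w dG (d2F (e i))).
rewrite big_split /=; congr (_ + _).
  by rewrite [RHS]derive_row_expansion //; exact: nbhs_singleton dF.
by rewrite [RHS]derive2_row_expansion.
Qed.

Section ProductRules.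
Context {R : realType} {V : normedModType R}.
Implicit Types (a b c : V -> 'rV[R]_3) (x v : V).

Lemma is_derive_dot a b x v da db : is_derive x v a da -> is_derive x v b db ->
  is_derive x v (fun y => dot (a y) (b y)) (dot da (b x) + dot (a x) db).
Proof.
move=> ha hb.
have ca i : is_derive x v (fun y => a y 0 i) (da 0 i).
  by have [d <-] := ha; exact: is_derive_coord.
have cb i : is_derive x v (fun y => b y 0 i) (db 0 i).
  by have [d <-] := hb; exact: is_derive_coord.
rewrite (_ : (fun y => _) = (fun y => a y 0 0) * (fun y => b y 0 0) +
  (fun y => a y 0 1) * (fun y => b y 0 1) +
  (fun y => a y 0 2) * (fun y => b y 0 2)); last first.
  by apply/funext => y; rewrite dotE !fctE.
have H := is_deriveD (is_deriveD (is_deriveM (ca 0) (cb 0))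
  (is_deriveM (ca 1) (cb 1))) (is_deriveM (ca 2) (cb 2)).
apply: (is_derive_eq H); rewrite !dotE /GRing.scale /=; ring.
Qed.

Lemma is_derive_det3 a b c x v da db dc :
  is_derive x v a da -> is_derive x v b db -> is_derive x v c dc ->
  is_derive x v (fun y => det3 (a y) (b y) (c y))
    (det3 da (b x) (c x) + det3 (a x) db (c x) + det3 (a x) (b x) dc).
Proof.
move=> ha hb hc.
have ca i : is_derive x v (fun y => a y 0 i) (da 0 i).
  by have [d <-] := ha; exact: is_derive_coord.
have cb i : is_derive x v (fun y => b y 0 i) (db 0 i).
  by have [d <-] := hb; exact: is_derive_coord.
have cc i : is_derive x v (fun y => c y 0 i) (dc 0 i).
  by have [d <-] := hc; exact: is_derive_coord.
pose A i y := a y 0 i; pose B i y := b y 0 i; pose C i y := c y 0 i.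
rewrite (_ : (fun y => _) = A 0 * (B 1 * C 2 - B 2 * C 1) +
  A 1 * (B 2 * C 0 - B 0 * C 2) + A 2 * (B 0 * C 1 - B 1 * C 0)); last first.
  by apply/funext => y; rewrite det3E !fctE.
have minor i j : is_derive x v (B i * C j - B j * C i)
    (B i x * dc 0 j + C j x * db 0 i - (B j x * dc 0 i + C i x * db 0 j)).
  exact: (is_deriveB (is_deriveM (cb i) (cc j)) (is_deriveM (cb j) (cc i))).
have H := is_deriveD (is_deriveD (is_deriveM (ca 0) (minor 1 2))
  (is_deriveM (ca 1) (minor 2 0))) (is_deriveM (ca 2) (minor 0 1)).
apply: (is_derive_eq H); rewrite !det3E /GRing.scale !fctE /=.
rewrite /A /B /C; ring.
Qed.

Lemma differentiable_det3 a b c x :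
  differentiable a x -> differentiable b x -> differentiable c x ->
  differentiable (fun y => det3 (a y) (b y) (c y) : R) x.
Proof.
move=> ha hb hc.
pose A i y : R := a y 0 i; pose B i y : R := b y 0 i; pose C i y : R := c y 0 i.
have ca i : differentiable (A i) x by exact: differentiable_entry.
have cb i : differentiable (B i) x by exact: differentiable_entry.
have cc i : differentiable (C i) x by exact: differentiable_entry.
rewrite (_ : (fun y => _) = A 0 * (B 1 * C 2 - B 2 * C 1) +
  A 1 * (B 2 * C 0 - B 0 * C 2) + A 2 * (B 0 * C 1 - B 1 * C 0)); last first.
  by apply/funext => y; rewrite det3E !fctE.
have minor i j : differentiable (B i * C j - B j * C i) x.
  by apply: differentiableB; apply: differentiableM.
by do 2?apply: differentiableD; apply: differentiableM.
Qed.

(** Applied to the second and third components v^2 and v^3 of the cuspidal model: at a zero of [p]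
    only the square has a nonzero second-order part. *)
Lemma derive2_power (p : V -> R) n x v w : twice_differentiable p x -> p x = 0 ->
  'D_w ('D_v (p ^+ n.+2)) x = if n is 0%N then 2 * 'D_w p x * 'D_v p x else 0.
Proof.
move=> [dp d2p] p0.
have dpx := nbhs_singleton dp.
rewrite (near_eq_derive (g := cst n.+2%:R * p ^+ n.+1 * 'D_v p)); last first.
  by apply: filterS dp => y dpy; rewrite (deriveX _ (diff_derivable dpy)) !fctE.
have hp : is_derive x w p ('D_w p x) by apply/derivableP/diff_derivable.
have hdp : is_derive x w ('D_v p) ('D_w ('D_v p) x).
  by apply/derivableP/diff_derivable/d2p.
have [_ ->] := is_deriveM (is_deriveM (is_derive_cst (n.+2%:R : R) x w)
  (is_deriveX n.+1 hp)) hdp.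
rewrite !fctE p0 expr0n /= /GRing.scale /=.
case: n => [|n] /=; rewrite ?expr0 ?expr0n /=; ring.
Qed.

(** Chain rule applied to [h \o g], which is the identity near [x]. *)
Lemma derive_left_inverse {W : normedModType R} (g : V -> W) (h : W -> V) x v :
  differentiable g x -> differentiable h (g x) -> (\forall y \near x, h (g y) = y) ->
  'D_('D_v g x) h (g x) = v.
Proof.
move=> dg dh hg; have [_ <-] := is_derive_comp v dg dh.
by rewrite (near_eq_derive (g := id)) ?derive_id.
Qed.

End ProductRules.

(** * An adapted frame at a cuspidal edge *)

Section CuspidalFrame.
Context {R : realType}.
Variables (f : 'rV[R]_2 -> 'rV[R]_3) (q : 'rV[R]_2).

Lemma cuspidal_frame : smooth_at q f -> cuspidal_edge f q ->
  exists T E : 'rV[R]_2,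
  [/\ (forall X, exists x y, X = x *: T + y *: E),
      'D_E f q = 0, 'D_T f q != 0,
      (exists c, 'D_T ('D_E f) q = c *: 'D_T f q) &
      forall c, 'D_E ('D_E f) q != c *: 'D_T f q].
Proof.
move=> /smooth_at_twice d2f [phi [Phi []]] phi0 [sphi [psi []]].
rewrite phi0 => spsi psiphi phipsi [sPhi [Psi []]] sPsi PsiPhi _ model.
have dphi := nbhs_singleton (smooth_at_twice sphi).1.
have d2psi := smooth_at_twice spsi; have dpsi := nbhs_singleton d2psi.1.
have d2Phi := smooth_at_twice sPhi; have dPhi := nbhs_singleton d2Phi.1.
have dPsi := nbhs_singleton (smooth_at_twice sPsi).1.
have df := nbhs_singleton d2f.1.
have psiq : psi q = 0 by rewrite -phi0; exact: nbhs_singleton psiphi.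
(* [k] is read in two ways near [q]: by the chain rule through [f] and [Phi], and as the cuspidal
   model in the coordinates [psi]. Comparing derivatives of the two gives all claims. *)
pose k := Phi \o f.
have kmodel : \forall z \near q, k z = cuspidal_model (psi z).
  have cpsi : psi @ q --> 0 by rewrite -psiq; exact: differentiable_continuous.
  have := cpsi _ model; apply: filterS2 phipsi => z pz /=.
  by rewrite /k /= pz.
pose e (i : 'I_2) : 'rV[R]_2 := delta_mx 0 i.
pose T := 'D_(e 0) phi 0; pose E := 'D_(e 1) phi 0.
have dpsiT : 'D_T psi q = e 0.
  by rewrite -phi0; apply: derive_left_inverse => //; rewrite phi0.
have dpsiE : 'D_E psi q = e 1.
  by rewrite -phi0; apply: derive_left_inverse => //; rewrite phi0.
(* Differentiating [phi (psi z) = z] shows that the coefficients of [X] are the coordinates of its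
   image under the differential of [psi]. *)
have basis X : exists x y, X = x *: T + y *: E.
  exists ('D_X psi q 0 0), ('D_X psi q 0 1).
  have phipsi' : \forall z \near q, phi (psi z) = z by [].
  rewrite -[LHS](derive_left_inverse X dpsi _ phipsi') psiq //.
  by rewrite derive_plane.
clearbody T E.
have dPhi_inj z : 'D_z Phi (f q) = 0 -> z = 0.
  move=> z0; rewrite -(derive_left_inverse z dPhi dPsi PsiPhi) z0.
  exact: derive0.
have dPhif : \forall z \near q, differentiable Phi (f z).
  have cf : f @ q --> f q := differentiable_continuous df.
  exact: (cf _ d2Phi.1).
have kE v : \forall z \near q, 'D_('D_v f z) Phi (f z) = 'D_v k z.
  apply: filterS2 d2f.1 dPhif => z dfz dPz.
  by have [_ <-] := is_derive_comp v dfz dPz.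
have dk : \forall z \near q, differentiable k z.
  by apply: filterS2 d2f.1 dPhif => z; exact: differentiable_comp.
have dkx := nbhs_singleton dk.
pose p (i : 'I_2) z : R := psi z 0 i.
have d2p i : twice_differentiable (p i) q by exact: twice_differentiable_coord.
have dp i v : 'D_v (p i) q = 'D_v psi q 0 i by exact: derive_coord.
have pq i : p i q = 0 by rewrite /p psiq mxE.
have k0 : \forall z \near q, k z 0 0 = p 0 z.
  by apply: filterS kmodel => z ->; rewrite mxE.
have k1 : \forall z \near q, k z 0 1 = (p 1 ^+ 2) z.
  by apply: filterS kmodel => z ->; rewrite mxE fctE.
have k2 : \forall z \near q, k z 0 2 = (p 1 ^+ 3) z.
  by apply: filterS kmodel => z ->; rewrite mxE fctE.
have coordk v i (g : 'rV[R]_2 -> R) : (\forall z \near q, k z 0 i = g z) ->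
    'D_v k q 0 i = 'D_v g q.
  by move=> kg; rewrite -(derive_coord v 0 i dkx); exact: near_eq_derive.
have dpd v : derivable (p 1) q v by exact/diff_derivable/(nbhs_singleton (d2p 1).1).
(* The square and the cube contribute nothing, since [p 1] vanishes at [q]. *)
have firstk v : 'D_v k q = 'D_v psi q 0 0 *: delta_mx 0 0.
  apply: row3P; rewrite !mxE /=.
  - by rewrite (coordk v 0 _ k0) dp mulr1.
  - by rewrite (coordk v 1 _ k1) deriveX // pq mulr0 scale0r mulr0.
  - by rewrite (coordk v 2 _ k2) deriveX // pq expr0n /= mulr0 scale0r mulr0.
have dPhiZ X : 'D_('D_X f q) Phi (f q) = 'D_X k q by have := nbhs_singleton (kE X).
have dfE : 'D_E f q = 0.
  by apply: dPhi_inj; rewrite dPhiZ firstk dpsiE mxE /= scale0r.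
have dkT : 'D_T k q = delta_mx 0 0 by rewrite firstk dpsiT mxE /= scale1r.
(* The second derivative of [Phi] is taken in the direction ['D_E f q], which is zero; only the
   first differential of [Phi] remains. *)
have second w : is_derive q w ('D_E k) ('D_('D_w ('D_E f) q) Phi (f q)).
  have along := is_derive_along d2Phi df (diff_derivable (v := w) (d2f.2 E)).
  apply: near_eq_is_derive (kE E) _; apply: is_derive_eq along _.
  rewrite dfE.
  have -> : 'D_('D_w f q) ('D_0 Phi) (f q) = 0 by exact: derive2_0.
  exact: addr0.
have secondk w i (g : 'rV[R]_2 -> R) : (\forall z \near q, k z 0 i = g z) ->
    'D_('D_w ('D_E f) q) Phi (f q) 0 i = 'D_w ('D_E g) q.
  move=> kg; have [dEk <-] := second w.
  have [_ <-] := is_derive_coord 0 i dEk.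
  (* The inner derivatives must agree at all nearby points, so the equality of functions is needed
     around each such point; hence the interior. *)
  apply: near_eq_derive; apply: filterS2 dk (nbhs_interior kg) => z dkz kgz.
  by rewrite -(derive_coord E 0 i dkz); exact: near_eq_derive.
have second1 w : 'D_('D_w ('D_E f) q) Phi (f q) 0 1 = 2 * 'D_w psi q 0 1.
  by rewrite (secondk w 1 _ k1) derive2_power // !dp dpsiE !mxE /= mulr1.
have second2 w : 'D_('D_w ('D_E f) q) Phi (f q) 0 2 = 0.
  by rewrite (secondk w 2 _ k2) derive2_power.
exists T, E; split => //.
- apply/eqP => Z0; have := dPhiZ T; rewrite Z0 derive0 dkT => /rowP/(_ 0).
  by rewrite !mxE /= => /eqP; rewrite eq_sym oner_eq0.
(* The differential of [Phi] is injective and sends ['D_T f q] to the first basis vector. The image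
   of [A] has zero second and third coordinates, so its first coordinate is the factor sought. *)
- set A := 'D_T _ q; pose c := 'D_A Phi (f q) 0 0.
  exists c; apply/eqP; rewrite -subr_eq0; apply/eqP/dPhi_inj.
  rewrite -scaleNr derive_addl // derive_scalel // dPhiZ dkT.
  apply: row3P; rewrite !mxE /=.
  + by rewrite mulr1 subrr.
  + by rewrite second1 dpsiT mxE /= !mulr0 addr0.
  + by rewrite second2 mulr0 addr0.
(* The second coordinate of the image under the differential of [Phi] is 2 for ['D_E ('D_E f) q] and
   0 for every multiple of ['D_T f q]. *)
- move=> c; apply/eqP => EE; have := second1 E; rewrite EE derive_scalel //.
  rewrite dPhiZ dkT dpsiE !mxE /= mulr0 mulr1 => /eqP.
  by rewrite eq_sym pnatr_eq0.
Qed.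
End CuspidalFrame.

(** * Fundamental forms and the curvature parabola *)

Section NormalProjection.
Context {R : realType}.
Variables (f : 'rV[R]_2 -> 'rV[R]_3) (q : 'rV[R]_2).
Local Notation J := ('J f q).
Local Notation N := (normal_plane f q).
Local Notation P := (normal_proj f q).

Lemma normal_planeP (w : 'rV[R]_3) :
  (w <= N)%MS <-> forall X, dot w (X *m J) = 0.
Proof.
have dotJ X : dot w (X *m J) = (w *m J^T *m X^T) 0 0.
  by rewrite /dot trmx_mul mulmxA.
split=> [/sub_kermxP wJ X|H]; first by rewrite dotJ wJ mul0mx mxE.
apply/sub_kermxP/rowP => i; have := H (delta_mx 0 i).
by rewrite dotJ trmx_delta -colE !mxE.
Qed.

(** A vector in both spaces is orthogonal to itself. Together with [full], this makes [normal_proj]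
    the projection of a direct sum. *)
Let disjoint : (N :&: <<J>>)%MS = 0.
Proof.
apply/eqP/rowV0P => v; rewrite sub_capmx genmxE => /andP[/normal_planeP vN].
by move=> /submxP[X vX]; apply/eqP; rewrite -dot_eq0 {2}vX vN.
Qed.

Let full (w : 'rV[R]_3) : (w <= N + <<J>>)%MS.
Proof.
apply: submx_full; rewrite /row_full mxrank_disjoint_sum // genmxE.
by rewrite mxrank_ker mxrank_tr subnK // rank_leq_col.
Qed.

Lemma normal_proj_sub w : (P w <= N)%MS.
Proof. exact: proj_mx_sub. Qed.

Lemma normal_proj_orthogonal w X : dot (P w) (X *m J) = 0.
Proof. by have /normal_planeP := normal_proj_sub w. Qed.

Lemma normal_proj_decomposition w : exists X, w = P w + X *m J.
Proof.
have := proj_mx_compl_sub (full w); rewrite genmxE => /submxP[X wX].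
by exists X; rewrite -wX addrC subrK.
Qed.

Lemma normal_proj_tangent X : P (X *m J) = 0.
Proof. by apply: proj_mx_0 => //; rewrite genmxE submxMl. Qed.

(** The single vector [b] stands for both mixed second derivatives, as in the coordinate formula of
    [fund2]. *)
Lemma normal_proj_bilinear x0 x1 y0 y1 (a b c : 'rV[R]_3) :
  P (y0 *: (x0 *: a + x1 *: b) + y1 *: (x0 *: b + x1 *: c)) =
  (x0 * y0) *: P a + (x0 * y1 + x1 * y0) *: P b + (x1 * y1) *: P c.
Proof.
rewrite /normal_proj !scalemxAl -!mulmxDl; congr (_ *m _).
by apply: row3P; rewrite !mxE; ring.
Qed.

Lemma dot_normal_proj w n : (forall X, dot (X *m J) n = 0) ->
  dot (P w) n = dot w n.
Proof.
move=> Jn; have [X wX] := normal_proj_decomposition w.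
by rewrite [in RHS]wX dotDl Jn addr0.
Qed.

End NormalProjection.

Section SecondForm.
Context {R : realType}.
Variables (f : 'rV[R]_2 -> 'rV[R]_3) (q : 'rV[R]_2).
Hypothesis d2f : twice_differentiable f q.

(** Coordinate-free form of II, with [X] and [Y] as constant fields. The symmetry of second
    derivatives identifies the two mixed terms. *)
Lemma fund2E X Y : fund2 f q X Y = normal_proj f q ('D_X ('D_Y f) q).
Proof.
pose e (i : 'I_2) : 'rV[R]_2 := delta_mx 0 i.
pose d i j : 'rV[R]_3 := 'D_(e i) ('D_(e j) f) q.
have -> : 'D_X ('D_Y f) q = Y 0 0 *: (X 0 0 *: d 0 0 + X 0 1 *: d 1 0) +
                            Y 0 1 *: (X 0 0 *: d 1 0 + X 0 1 *: d 1 1).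
  apply: etrans (derive2_plane X Y d2f) _; congr (_ *: _ + _ *: _).
    exact: derive_plane (d2f.2 _).
  have <- : d 0 1 = d 1 0 by exact: derive_symm_mx.
  exact: derive_plane (d2f.2 _).
by rewrite normal_proj_bilinear.
Qed.

Lemma fund1E X Y : fund1 f q X Y = dot ('D_X f q) ('D_Y f q).
Proof. by rewrite /fund1 !deriveE //; exact: nbhs_singleton d2f.1. Qed.

Lemma fund2_scale c X : fund2 f q (c *: X) (c *: X) = c ^+ 2 *: fund2 f q X X.
Proof.
rewrite /fund2.
generalize (normal_proj f q (partial 0 (partial 0 f) q))
  (normal_proj f q (partial 1 (partial 0 f) q))
  (normal_proj f q (partial 1 (partial 1 f) q)) => u v w.
by apply: row3P; rewrite !mxE; ring.
Qed.

Lemma fund2_combine x y T E : fund2 f q (x *: T + y *: E) (x *: T + y *: E) =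
  x ^+ 2 *: fund2 f q T T + (x * y) *: (fund2 f q T E + fund2 f q E T) +
  y ^+ 2 *: fund2 f q E E.
Proof.
rewrite /fund2.
generalize (normal_proj f q (partial 0 (partial 0 f) q))
  (normal_proj f q (partial 1 (partial 0 f) q))
  (normal_proj f q (partial 1 (partial 1 f) q)) => u v w.
by apply: row3P; rewrite !mxE; ring.
Qed.

Lemma fund2C X Y : fund2 f q X Y = fund2 f q Y X.
Proof.
rewrite /fund2 [X 0 0 * Y 0 0]mulrC [X 0 1 * Y 0 1]mulrC.
by rewrite (_ : X 0 0 * Y 0 1 + _ = Y 0 0 * X 0 1 + Y 0 1 * X 0 0) //; ring.
Qed.

Lemma jacobianE X : X *m 'J f q = 'D_X f q.
Proof. by rewrite deriveEjacobian //; exact: nbhs_singleton d2f.1. Qed.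

End SecondForm.

(** * The umbilic curvature of a half-line *)

Section UmbilicCurvature.
Context {R : realType}.

(** These curves include b + t^2 w, a smooth parametrization of the half-line from [b] in direction
    [w]. *)
Let quadratic (a b c : 'rV[R]_3) (t : R^o) := a + t *: b + (t * t) *: c.

Lemma is_derive_quadratic (a b c : 'rV[R]_3) (t v : R^o) :
  is_derive t v (quadratic a b c) (quadratic (v *: b) ((2 * v) *: c) 0 t).
Proof.
have D := is_deriveD (is_deriveD (is_derive_cst a t v)
  (is_derive_scale (is_derive_id t v) (is_derive_cst b t v)))
  (is_derive_scale (is_deriveM (is_derive_id t v) (is_derive_id t v))
    (is_derive_cst c t v)).
apply: (is_derive_eq D); rewrite /quadratic /GRing.scale /=.
by apply: row3P; rewrite !mxE; ring.
Qed.

(** The family is closed under directional derivatives, so the induction on the order runs over all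
    coefficients at once. *)
Lemma smooth_quadratic (a b c : 'rV[R]_3) : smooth_on [set: R^o] (quadratic a b c).
Proof.
have diffq (a' b' c' : 'rV[R]_3) (t : R^o) : differentiable (quadratic a' b' c') t.
  apply: differentiableD; first apply: differentiableD.
  - exact: differentiable_cst.
  - exact: differentiableZl.
  - by apply: differentiableZl; exact: (@differentiableM _ _ id id).
move=> n; elim: n a b c => [|n IH] a b c /=.
  by move=> t _; exact/differentiable_continuous/diffq.
split=> [t _|v]; first exact: diffq.
rewrite (_ : 'D_v _ = quadratic (v *: b) ((2 * v) *: c) 0) //.
by apply/funext => t; have [_ ->] := is_derive_quadratic a b c t v.
Qed.

Section HalfLine.
Variables (f : 'rV[R]_2 -> 'rV[R]_3) (q : 'rV[R]_2) (b w z n : 'rV[R]_3).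
Hypothesis parabola : curvature_parabola f q = [set b + s *: w | s in [set s | 0 <= s]].
Hypotheses (z0 : z != 0) (n1 : dot n n = 1) (w0 : w != 0).
Hypotheses (zn : dot z n = 0) (zw : dot z w = 0) (nw : dot n w = 0).
Hypothesis (bz : dot b z = 0).

(** As [alpha] stays on the line through [b] directed by [w], its derivative is a multiple of [w];
    the quotient is then the distance from the origin to that line. *)
Lemma parametrization_curvature (alpha : R -> 'rV[R]_3) s :
  smooth_on [set: R^o] alpha -> range alpha = curvature_parabola f q ->
  derive1 alpha s != 0 ->
  enorm (cross (alpha s) (derive1 alpha s)) / enorm (derive1 alpha s) = `|dot b n|.
Proof.
move=> sm; rewrite parabola => rng.
have ww : dot w w != 0 by rewrite dot_eq0.
(* The parameter of [alpha t] on the line is recovered by projecting onto [w], which makes it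
   differentiable. *)
pose sigma t := dot (alpha t - b) w / dot w w.
have alphaE t : alpha t = b + sigma t *: w.
  have : range alpha (alpha t) by exists t.
  rewrite rng /sigma => -[u _ <-]; rewrite addrAC subrr add0r dotZl.
  by rewrite mulfK.
have dalpha : is_derive s 1 alpha (derive1 alpha s).
  rewrite derive1E; apply/derivableP/diff_derivable.
  by have [da _] := sm 1%N; exact: da.
have dE : derive1 alpha s = (dot (derive1 alpha s) w / dot w w) *: w.
  have D1 := is_derive_dot (is_deriveB dalpha (is_derive_cst b s 1))
    (is_derive_cst w s 1).
  have D2 := is_derive_scale (is_deriveZ (dot w w)^-1 D1) (is_derive_cst w s 1).
  have D3 := is_deriveD (is_derive_cst b s 1) D2.
  have alphaD : alpha = cst b +
      (fun t => ((dot w w)^-1 \*: (fun t => dot (alpha t - b) w)) t *: w).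
    by apply/funext => t; rewrite [LHS]alphaE /sigma mulrC.
  rewrite {1}alphaD derive1E; have [_ ->] := D3.
  by rewrite add0r subr0 [dot _ 0]dotC dot0l addr0 scaler0 addr0 [_ *: dot _ _]mulrC.
move: dE; move: (derive1 alpha s) => d dE d0.
have k0 : dot d w / dot w w != 0.
  by apply: contraNneq d0 => k0; rewrite dE k0 scale0r.
(* The nonzero derivative [d] replaces [w] as third vector of the frame. *)
rewrite (@enorm_cross_frame _ z n d) //.
- by rewrite alphaE dotDl dotZl (dotC w) nw mulr0 addr0.
- by rewrite dE dotZr zw mulr0.
- by rewrite dE dotZr nw mulr0.
- by rewrite alphaE dotDl dotZl bz (dotC w) zw mulr0 addr0.
Qed.

(** All admissible values agree by [parametrization_curvature], and t -> b + t^2 w provides one, so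
    the default of [xget] is not reached. *)
Lemma umbilic_curvatureE : umbilic_curvature f q = `|dot b n|.
Proof.
apply: xget_unique; last first.
  by move=> _ [alpha [s [? ? ? ->]]]; exact: parametrization_curvature.
have sm := smooth_quadratic b 0 w.
have rng : range (quadratic b 0 w) = curvature_parabola f q.
  rewrite parabola; apply/seteqP; split=> [_ [t _ <-]|_ [s /= s0 <-]].
    by exists (t * t); rewrite /= -?expr2 ?sqr_ge0 // /quadratic scaler0 addr0 expr2.
  exists (Num.sqrt s) => //.
  by rewrite /quadratic scaler0 addr0 -expr2 sqr_sqrtr.
(* The parameter 1 is chosen because the derivative 2 t w vanishes at 0. *)
have d0 : derive1 (quadratic b 0 w) 1 != 0.
  rewrite derive1E; have [_ ->] := is_derive_quadratic b 0 w 1 1.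
  rewrite /quadratic !scaler0 add0r addr0 scale1r mulr1 scaler_eq0 (negbTE w0) orbF.
  by rewrite pnatr_eq0.
exists (quadratic b 0 w), 1; split => //.
by rewrite (parametrization_curvature sm rng d0).
Qed.
End HalfLine.
End UmbilicCurvature.

(** Both lines pass through [b] and [b + w]; this gives the uniqueness of the line containing the
    curvature parabola. *)
Lemma line_eq_two_points {R : realType} (V : lmodType R) (a d b w : V) s0 s1 :
  w != 0 -> a + s0 *: d = b -> a + s1 *: d = b + w ->
  [set a + t *: d | t in [set: R]] = [set b + t *: w | t in [set: R]].
Proof.
move=> w0 <- e1.
have wE : w = (s1 - s0) *: d.
  by rewrite -(addKr (a + s0 *: d) w) -e1 opprD addrACA addNr add0r addrC scalerBl.
have s10 : s1 - s0 != 0 by apply: contraNneq w0 => s10; rewrite wE s10 scale0r.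
apply/seteqP; split=> _ [t _ <-].
  exists ((t - s0) / (s1 - s0)) => //.
  by rewrite wE scalerA divfK // -addrA -scalerDl [s0 + _]addrC subrK.
by exists (s0 + t * (s1 - s0)); rewrite // wE scalerA scalerDl addrA.
Qed.

(** * Fundamental forms and umbilic curvature in the adapted frame *)

Section CuspidalEdgeForms.
Context {R : realType}.
Variables (f nu : 'rV[R]_2 -> 'rV[R]_3) (q T E : 'rV[R]_2).
Hypotheses (d2f : twice_differentiable f q) (d2nu : twice_differentiable nu q).
Hypothesis basis : forall X, exists x y, X = x *: T + y *: E.
Hypotheses (dfE : 'D_E f q = 0) (dfT : 'D_T f q != 0).
Hypothesis dTE : exists c, 'D_T ('D_E f) q = c *: 'D_T f q.
Hypothesis dEE : forall c, 'D_E ('D_E f) q != c *: 'D_T f q.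
Hypothesis nu1 : enorm (nu q) = 1.
Hypothesis nu_orthogonal :
  \forall x \near q, forall v : 'rV[R]_2, dot ('d f x v) (nu x) = 0.

Local Notation z := ('D_T f q).
Local Notation n := (nu q).
Local Notation II := (fund2 f q).
Local Notation a := (II T T).
Local Notation w := (II E E).

Let df : differentiable f q. Proof. exact: nbhs_singleton d2f.1. Qed.

Lemma differential_frame x y : 'D_(x *: T + y *: E) f q = x *: z.
Proof. exact: derive_mod_null. Qed.

Let tangent_nu X : dot ('D_X f q) n = 0.
Proof. by rewrite deriveE //; have := nbhs_singleton nu_orthogonal; apply. Qed.

Let zn : dot z n = 0. Proof. exact: tangent_nu. Qed.

Let n1 : dot n n = 1. Proof. by rewrite -enorm_sqr nu1 expr1n. Qed.

Lemma tangent_image X : exists x, X *m 'J f q = x *: z.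
Proof.
have [x [y ->]] := basis X; exists x.
by rewrite jacobianE // differential_frame.
Qed.

Lemma fund2_orthogonal X Y v : dot (II X Y) ('D_v f q) = 0.
Proof. by rewrite (fund2E d2f) -(jacobianE d2f v) normal_proj_orthogonal. Qed.

Lemma dot_fund2_normal X Y : dot (II X Y) n = dot ('D_X ('D_Y f) q) n.
Proof.
rewrite (fund2E d2f); apply: dot_normal_proj => v.
by rewrite (jacobianE d2f v); exact: tangent_nu.
Qed.

Let az : dot a z = 0. Proof. exact: fund2_orthogonal. Qed.

Let zw : dot z w = 0. Proof. by rewrite dotC fund2_orthogonal. Qed.

(** Otherwise ['D_E ('D_E f) q] would be tangent, hence a multiple of ['D_T f q]. *)
Lemma fund2_null_neq0 : w != 0.
Proof.
apply/eqP; rewrite (fund2E d2f) => P0.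
have [X] := normal_proj_decomposition f q ('D_E ('D_E f) q).
have [c ->] := tangent_image X; rewrite P0 add0r => Ec.
by have := dEE c; rewrite {1}Ec eqxx.
Qed.
Let w0 := fund2_null_neq0.

(* Differentiate <D_E f, nu> = 0 along E and use that D_E f vanishes at q. *)
Lemma fund2_null_normal : dot n w = 0.
Proof.
rewrite dotC dot_fund2_normal.
have dEf : is_derive q E ('D_E f) ('D_E ('D_E f) q).
  by apply/derivableP/diff_derivable/d2f.2.
have dnu : is_derive q E nu ('D_E nu q).
  by apply/derivableP/diff_derivable; exact: nbhs_singleton d2nu.1.
have [_] := is_derive_dot dEf dnu; rewrite dfE dot0l addr0 => <-.
rewrite (near_eq_derive (g := cst 0)) ?derive_cst //.
by apply: filterS2 d2f.1 nu_orthogonal => y dfy ny; rewrite deriveE.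
Qed.
Let nw := fund2_null_normal.

Lemma fund2_mixed : II T E = 0.
Proof.
have [c cE] := dTE.
rewrite (fund2E d2f) cE -(derive_scalel c T df) -(jacobianE d2f (c *: T)).
exact: normal_proj_tangent.
Qed.

Lemma fund2_frame x y :
  II (x *: T + y *: E) (x *: T + y *: E) = x ^+ 2 *: a + y ^+ 2 *: w.
Proof. by rewrite fund2_combine (fund2C _ _ E T) fund2_mixed addr0 scaler0 addr0. Qed.

Lemma fund1_frame x y :
  fund1 f q (x *: T + y *: E) (x *: T + y *: E) = x ^+ 2 * dot z z.
Proof. by rewrite fund1E // !differential_frame dotZl dotZr mulrA. Qed.

(** The end point of the half-line: the value of II(X,X) at the unit multiple of [T]. *)
Local Notation b := ((dot z z)^-1 *: a).

Let zz : 0 < dot z z. Proof. exact: dot_gt0. Qed.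

(** For X = xT + yE, the condition I(X,X) = 1 fixes x^2 as the inverse of |z|^2 and leaves y free,
    so s = y^2 takes every nonnegative value. *)
Lemma curvature_parabola_half_line :
  curvature_parabola f q = [set b + s *: w | s in [set s | 0 <= s]].
Proof.
apply/seteqP; split=> [_ [X /= X1 <-]|_ [s /= s0 <-]].
  have [x [y XE]] := basis X; rewrite XE in X1 *.
  rewrite fund2_frame; exists (y ^+ 2); rewrite /= ?sqr_ge0 //.
  have xz : x ^+ 2 * dot z z = 1.
    rewrite -[LHS]sqr_sqrtr ?(mulr_ge0 (sqr_ge0 x) (ltW zz)) //.
    by rewrite -(fund1_frame x y) X1 expr1n.
  by rewrite -[x ^+ 2](mulfK (lt0r_neq0 zz)) xz mul1r.
exists (Num.sqrt (dot z z)^-1 *: T + Num.sqrt s *: E) => /=.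
  rewrite fund1_frame sqr_sqrtr ?invr_ge0 ?(ltW zz) // mulVf ?sqrtr1 //.
  exact: lt0r_neq0.
by rewrite fund2_frame !sqr_sqrtr // invr_ge0 ltW.
Qed.

Lemma parabola_line : exists l : set 'rV[R]_3,
  [/\ line_in (normal_plane f q) l,
      curvature_parabola f q `<=` l,
      (forall l' : set 'rV[R]_3, line_in (normal_plane f q) l' ->
         curvature_parabola f q `<=` l' -> l' = l) &
      orthogonal_line n l].
Proof.
have sub X Y : (II X Y <= normal_plane f q)%MS.
  by rewrite (fund2E d2f) normal_proj_sub.
exists [set b + t *: w | t in [set: R]]; split.
- by exists b, w; rewrite scalemx_sub.
- by rewrite curvature_parabola_half_line => _ [s _ <-]; exists s.
- rewrite curvature_parabola_half_line => l' [a' [d [_ _ d0 ->]]] H.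
  (* The points s = 0 and s = 1 of the half-line already determine the line. *)
  have /H[t0 _ t0E] : [set b + s *: w | s in [set s | 0 <= s]] b.
    by exists 0 => /=; rewrite // scale0r addr0.
  have /H[t1 _ t1E] : [set b + s *: w | s in [set s | 0 <= s]] (b + w).
    by exists 1 => /=; rewrite // scale1r.
  exact: line_eq_two_points w0 t0E t1E.
- move=> _ _ [s _ <-] [t _ <-].
  by rewrite dotC opprD addrACA subrr add0r -scalerBl dotZl dotC nw mulr0.
Qed.

Lemma umbilic_curvature_frame : umbilic_curvature f q = `|dot b n|.
Proof.
apply: umbilic_curvatureE curvature_parabola_half_line dfT n1 w0 zn zw nw _.
by rewrite dotZl az mulr0.
Qed.

(** Only the [T]-coefficient x of [X] matters: I ignores [E], and II(E,E) is orthogonal to nu(q).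
    The factor x^2 then cancels. *)
Lemma umbilic_curvature_fund2 X : fund1 f q X X != 0 ->
  umbilic_curvature f q = `|fund2_along f q n X X| / fund1 f q X X.
Proof.
have [x [y ->]] := basis X; rewrite fund1_frame => x0.
rewrite umbilic_curvature_frame /fund2_along fund2_frame dotDl !dotZl (dotC w) nw.
rewrite mulr0 addr0 (normrM (x ^+ 2)) (normrM (dot z z)^-1) normfV (gtr0_norm zz).
rewrite (ger0_norm (sqr_ge0 x)) invfM mulrACA divff ?mul1r 1?mulrC //.
by apply: contraNneq x0 => ->; rewrite mul0r.
Qed.

(** * Second-order data of a curve through [q] *)

Section Curve.
Variables (gamma : R -> 'rV[R]_2) (t0 : R).
Hypotheses (d2g : twice_differentiable (gamma : R^o -> _) t0) (gq : gamma t0 = q).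
Local Notation g := (derive1 gamma t0).

Lemma derive_curve : derive1 (f \o gamma) t0 = 'D_g f q.
Proof.
have dg : differentiable (gamma : R^o -> _) t0 := nbhs_singleton d2g.1.
have dfg : differentiable f (gamma t0) by rewrite gq.
have [_ D] := is_derive_comp (1 : R^o) dg dfg.
by apply: etrans (derive1E _ _) _; rewrite D derive1E gq.
Qed.

Lemma derive2_curve : derive1n 2 (f \o gamma) t0 =
  'D_(derive1n 2 gamma t0) f q + 'D_g ('D_g f) q.
Proof.
have d2fg : twice_differentiable f (gamma t0) by rewrite gq.
have dg : differentiable (gamma : R^o -> _) t0 := nbhs_singleton d2g.1.
have cg : (gamma : R^o -> _) @ t0 --> gamma t0 := differentiable_continuous dg.
have gE : derive1 gamma = 'D_(1 : R^o) gamma by apply/funext => t; rewrite derive1E.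
have along := is_derive_along d2fg dg (diff_derivable (v := (1 : R^o)) (d2g.2 1)).
have g2E : derive1n 2 gamma t0 = 'D_(1 : R^o) ('D_(1 : R^o) gamma) t0.
  by rewrite -gE -derive1E.
have dfg : \forall t \near t0, differentiable f (gamma t) by exact: (cg _ d2fg.1).
have first : \forall t \near t0,
    'D_('D_(1 : R^o) gamma t) f (gamma t) = derive1 (f \o gamma) t.
  apply: filterS2 d2g.1 dfg => t dgt dft; rewrite derive1E.
  by have [_ ->] := is_derive_comp (1 : R^o) dgt dft.
have [_ D] := near_eq_is_derive first along.
by rewrite g2E (derive1E gamma) -gq -D -derive1E.
Qed.

(** The term of the second derivative that contains gamma'' is tangent, hence orthogonal to
    nu(q). *)
Lemma signed_normal_curvature_fund2 :
  signed_normal_curvature f nu gamma t0 = fund2_along f q n g g / fund1 f q g g.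
Proof.
rewrite /signed_normal_curvature derive2_curve derive_curve enorm_sqr gq.
rewrite (fund1E d2f g g) /fund2_along; congr (_ / _).
apply: etrans (dotDl _ _ _) _.
apply: etrans (congr1 (fun t => t + _) (tangent_nu _)) _; rewrite add0r.
exact/esym/dot_fund2_normal.
Qed.

(** The image of the differential is a line, so the gamma'' term and the tangential part of
    ['D_g ('D_g f) q] are collinear with ['D_T f q], as is the first row; they drop out of the
    determinant. *)
Lemma det3_curve : det3 (derive1 (f \o gamma) t0) (derive1n 2 (f \o gamma) t0) n =
  det3 ('D_g f q) (II g g) n.
Proof.
rewrite derive2_curve derive_curve [in RHS]fund2E //.
have [X XE] := normal_proj_decomposition f q ('D_g ('D_g f) q).
have [c cE] := tangent_image X; rewrite {1}XE cE.
have [x [y ->]] := basis g; have [x' [y' ->]] := basis (derive1n 2 gamma t0).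
by rewrite !differential_frame !det3E !mxE; ring.
Qed.

End Curve.

(** * The area density differentiated in the null direction *)

Lemma derive_area_density :
  is_derive q E (area_density f nu)
   (det3 ('D_E (partial 0 f) q) (partial 1 f q) n +
    det3 (partial 0 f q) ('D_E (partial 1 f) q) n +
    det3 (partial 0 f q) (partial 1 f q) ('D_E nu q)).
Proof.
apply: is_derive_det3; apply/derivableP/diff_derivable.
- exact: d2f.2.
- exact: d2f.2.
- exact: nbhs_singleton d2nu.1.
Qed.

(** The determinant [D] of ['D_T f q], ['D_E ('D_E f) q] and nu(q) equals det(T, E) times the
    derivative in question, and [D] is nonzero. *)
Lemma area_density_null_neq0 : 'D_E (area_density f nu) q != 0.
Proof.
have [_ ->] := derive_area_density.
set e0 : 'rV[R]_2 := delta_mx 0 0; set e1 : 'rV[R]_2 := delta_mx 0 1.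
have [x0 [y0 e0E]] := basis e0; have [x1 [y1 e1E]] := basis e1.
have f0 : partial 0 f q = x0 *: z by rewrite /partial -/e0 e0E differential_frame.
have f1 : partial 1 f q = x1 *: z by rewrite /partial -/e1 e1E differential_frame.
(* At [q], ['D_X f] is [z] times the linear form with coefficients [x0], [x1]; this form is 0 on [E]
   and 1 on [T]. *)
have Ex : E 0 0 * x0 + E 0 1 * x1 = 0.
  have : (E 0 0 * x0 + E 0 1 * x1) *: z = 0.
    by rewrite -dfE (derive_plane E df) scalerDl -!scalerA -f0 -f1.
  by move/eqP; rewrite scaler_eq0 (negbTE dfT) orbF => /eqP.
have Tx : T 0 0 * x0 + T 0 1 * x1 = 1.
  have : (T 0 0 * x0 + T 0 1 * x1 - 1) *: z = 0.
    rewrite scalerBl scale1r [X in _ - X](derive_plane T df).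
    by rewrite scalerDl -!scalerA -f0 -f1 subrr.
  by move/eqP; rewrite scaler_eq0 (negbTE dfT) orbF subr_eq0 => /eqP.
rewrite f0 f1; set u0 := 'D_E (partial 0 f) q; set u1 := 'D_E (partial 1 f) q.
have EE : 'D_E ('D_E f) q = E 0 0 *: u0 + E 0 1 *: u1 by exact: derive2_plane.
set D := det3 z ('D_E ('D_E f) q) n.
have D0 : D != 0.
  (* [D] sees only the normal part [w]. If it vanished, [w] would be parallel to nu(q), yet [w] is
     nonzero and orthogonal to it. *)
  apply/eqP => D0.
  have Dw : det3 z w n = 0.
    rewrite -D0 /D (fund2E d2f).
    have [X XE] := normal_proj_decomposition f q ('D_E ('D_E f) q).
    have [c cE] := tangent_image X; rewrite [in RHS]XE cE.
    by rewrite !det3E !mxE; ring.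
  have := det3_eq0_parallel dfT n1 zn _ Dw.
  rewrite dotC zw => /(_ erefl); rewrite dotC nw scale0r; exact/eqP.
apply: contraNneq D0; rewrite det3_collinear => L0.
have -> : D = E 0 0 * det3 z u0 n + E 0 1 * det3 z u1 n.
  by rewrite /D EE det3_combine.
move: L0; generalize (det3 z u0 n) (det3 z u1 n) => p r.
move: Ex Tx; generalize (E 0 0) (E 0 1) (T 0 0) (T 0 1) => E0 E1 T0 T1 Ex Tx L0.
apply/eqP; rewrite -[LHS]mul1r -Tx.
have -> : (T0 * x0 + T1 * x1) * (E0 * p + E1 * r) =
  (T0 * p + T1 * r) * (E0 * x0 + E1 * x1) +
  (T0 * E1 - T1 * E0) * (x0 * r - x1 * p) by ring.
by rewrite Ex L0 !mulr0 addr0.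
Qed.

End CuspidalEdgeForms.

Theorem theorem4p3 (R : realType) (f : 'rV[R]_2 -> 'rV[R]_3) (q : 'rV[R]_2)
    (nu : 'rV[R]_2 -> 'rV[R]_3)
    (f_smooth : smooth_at q f)
    (f_cuspidal : cuspidal_edge f q)
    (nu_normal : unit_normal f q nu) :
  (* (a) *)
  ((exists l : set 'rV[R]_3,
      [/\ line_in (normal_plane f q) l,
          curvature_parabola f q `<=` l,
          (forall l' : set 'rV[R]_3, line_in (normal_plane f q) l' ->
             curvature_parabola f q `<=` l' -> l' = l) &
          orthogonal_line (nu q) l]) /\
   (forall X : 'rV[R]_2, fund1 f q X X != 0 ->
      umbilic_curvature f q =
      `|fund2_along f q (nu q) X X| / fund1 f q X X)) /\
  (forall (gamma : R -> 'rV[R]_2) (t0 : R) (eta : 'rV[R]_2 -> 'rV[R]_2),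
     param_singular f q gamma t0 ->
     null_field f q eta ->
     pos_oriented gamma t0 eta ->
     [/\ (* (b) *)
         umbilic_curvature f q = normal_curvature f nu gamma t0,
         (* (c) *)
         (forall X : 'rV[R]_2, X != 0 -> tangent_at gamma t0 X ->
            (singular_curvature f nu gamma eta t0 = 0 <->
             exists c : R, fund2 f q X X = c *: nu q)) &
         (* (d) *)
         (forall X : 'rV[R]_2, X != 0 -> tangent_at gamma t0 X ->
            ((umbilic_curvature f q = 0 /\
              singular_curvature f nu gamma eta t0 = 0) <->
             fund2 f q X X = 0))]).

Proof.
have d2f := smooth_at_twice f_smooth.
have [T [E [basis dfE dfT dTE dEE]]] := cuspidal_frame f_smooth f_cuspidal.
have [/smooth_at_twice d2nu /nbhs_singleton nu1 nu_orth] := nu_normal.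
have umb := umbilic_curvature_fund2 d2f d2nu basis dfE dfT dTE dEE nu1 nu_orth.
split.
  split; last exact: umb.
  exact: (parabola_line d2f d2nu basis dfE dfT dTE dEE nu_orth).
move=> gamma t0 eta [sg gq _ /nbhs_singleton sing _] [_ _ /nbhs_singleton null].
move=> /nbhs_singleton; rewrite !gq in sing * => pos.
have d2g := smooth_at_twice sg.
set g := derive1 gamma t0 in pos *.
have n1 : dot (nu q) (nu q) = 1 by rewrite -enorm_sqr nu1 expr1n.
have zz := dot_gt0 dfT.
have df : differentiable f q by exact: nbhs_singleton d2f.1.
(* The kernel of the differential at [q] is spanned by [E], and positive orientation excludes eta(q)
   = 0. *)
have [k [k0 etaE]] : exists k, k != 0 /\ eta q = k *: E.
  have [x [y xyE]] := basis (eta q); exists y.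
  have x0 : x = 0.
    have := null sing; rewrite -deriveE // xyE (derive_mod_null _ _ _ df dfE).
    by move/eqP; rewrite scaler_eq0 (negbTE dfT) orbF => /eqP.
  rewrite {1}xyE x0 scale0r add0r; split=> //.
  apply: contraTneq pos => y0; rewrite xyE x0 y0 !scale0r addr0 det2E !mxE.
  by rewrite !mulr0 subrr ltxx.
(* Without a [T]-component, gamma' would be parallel to eta(q), against positive orientation. *)
have [x [y [x0 gE]]] : exists x y, x != 0 /\ g = x *: T + y *: E.
  have [x [y xyE]] := basis g; exists x, y; split=> //.
  apply: contraTneq pos => x0; rewrite xyE x0 etaE scale0r add0r det2E !mxE.
  by rewrite (_ : _ - _ = 0) ?ltxx //; ring.
have Igg : fund1 f q g g != 0.
  rewrite gE (fund1_frame T d2f dfE) mulf_neq0 ?expf_neq0 //; exact: lt0r_neq0.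
have tangentE X : X != 0 -> tangent_at gamma t0 X -> exists2 c, c != 0 & X = c *: g.
  move=> X0 [c Xc]; exists c => //.
  by apply: contraNneq X0 => c0; rewrite Xc c0 scale0r.
(* Both sides equal |II_nu(g,g)| / I(g,g), the left one by (a) with X = g. *)
have b_part : umbilic_curvature f q = normal_curvature f nu gamma t0.
  rewrite (umb g Igg) /normal_curvature.
  rewrite (signed_normal_curvature_fund2 d2f nu_orth d2g gq) normrM normfV.
  by rewrite [`|fund1 _ _ _ _|]ger0_norm // /fund1 dot_ge0.
have gz : 'D_g f q != 0.
  by rewrite gE (derive_mod_null _ _ _ df dfE) scaler_eq0 negb_or x0.
have gn : dot ('D_g f q) (nu q) = 0.
  by rewrite deriveE //; have := nbhs_singleton nu_orth; apply.
(* The sign factor is nonzero because eta(q) is a nonzero multiple of [E]. What remains is the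
   determinant of ['D_g f q], II(g,g) and nu(q), whose first row is orthogonal to the other two. *)
have ks0 : singular_curvature f nu gamma eta t0 = 0 <->
    exists c, fund2 f q g g = c *: nu q.
  rewrite /singular_curvature gq.
  have sg0 : Num.sg ('d (area_density f nu : _ -> R^o) q (eta q)) != 0.
    have dl : differentiable (area_density f nu : _ -> R^o) q.
      apply: differentiable_det3; [exact: d2f.2|exact: d2f.2|].
      exact: nbhs_singleton d2nu.1.
    rewrite sgr_eq0 -deriveE // etaE derive_scalel // mulf_neq0 //.
    exact: (area_density_null_neq0 d2f d2nu basis dfE dfT dEE nu1 nu_orth).
  rewrite (det3_curve nu d2f basis dfE d2g gq) (derive_curve d2f d2g gq) -/g.
  have e0 : enorm ('D_g f q) ^+ 3 != 0 by rewrite expf_neq0 // enorm_eq0.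
  split=> [/eqP|[c ->]]; last by rewrite det3Zn mul0r mulr0.
  rewrite !mulf_eq0 invr_eq0 (negbTE sg0) (negbTE e0) orbF => /eqP det0.
  exists (dot (fund2 f q g g) (nu q)).
  by apply: det3_eq0_parallel gz n1 gn _ det0; exact: fund2_orthogonal.
have c_part X : X != 0 -> tangent_at gamma t0 X ->
    (singular_curvature f nu gamma eta t0 = 0 <->
     exists c : R, fund2 f q X X = c *: nu q).
  move=> X0 /(tangentE X X0) [c c0 ->]; rewrite fund2_scale.
  apply: (iff_trans ks0); split=> -[l lE].
    by exists (c ^+ 2 * l); rewrite lE scalerA.
  exists ((c ^+ 2)^-1 * l); rewrite -scalerA -lE scalerA mulVf ?scale1r //.
  exact: expf_neq0.
split => // X X0 Xg.
have IX : fund1 f q X X != 0.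
  have [c c0 ->] := tangentE X X0 Xg.
  rewrite (fund1E d2f) (derive_scalel c g df) dotZl dotZr.
  by rewrite !mulf_neq0 // dot_eq0.
split.
  (* With II(X,X) = l nu(q), formula (a) gives kappa_u = |l| / I(X,X), so l = 0. *)
  move=> [u0 /(c_part X X0 Xg) [l lE]].
  move: u0; rewrite (umb X IX) /fund2_along lE dotZl n1 mulr1 => /eqP.
  rewrite mulf_eq0 invr_eq0 (negbTE IX) orbF normr_eq0 => /eqP ->.
  exact: scale0r.
move=> II0; split; last by apply/(c_part X X0 Xg); exists 0; rewrite scale0r.
by rewrite (umb X IX) /fund2_along II0 dot0l normr0 mul0r.
Qed.
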